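(* Let $I\subset\mathbb{R}$ be an open interval and let $\alpha: I\to E^3$ be a smooth unit speed curve with Frenet vectors $T,N,B$ and with non-zero curvature $\kappa$ and non-zero torsion $\tau$. Then $\alpha$ is a Bertrand curve if and only if $$\lambda\,\|T'(s)\|+\eta\,\|B'(s)\|=1\qquad\text{for all } s\in I$$ for some real constants $\lambda$ and $\eta$.
   Context: $E^3$ is Euclidean 3-space and primes denote derivatives with respect to the arclength parameter $s$. The Frenet vectors are $T=\alpha'$, $N=T'/\|T'\|$, $B=T\times N$, with $T'=\kappa N$, $N'=-\kappa T+\tau B$, $B'=-\tau N$. The curve $\alpha$ is a Bertrand curve if there is a regular smooth curve $\alpha^*:I\to E^3$, different from $\alpha$, such that at corresponding points $\alpha(s),\alpha^*(s)$ the principal normal lines coincide. That is, the line through $\alpha(s)$ with direction $N(s)$ contains $\alpha^*(s)$, and, with $T^*$ the unit tangent of $\alpha^*$, $N(s)$ is orthogonal to $T^*(s)$ and $(T^* )'(s)$ is a multiple of $N(s)$.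
   Formalization: The constant λ is required to be non-zero; with λ = 0 allowed the ''if'' direction fails, e.g. for a curve with torsion 1 and non-constant curvature (λ = 0, η = 1), which is not a Bertrand curve. *)

(* Defs.v *)
From Stdlib Require Import Reals.
From Coquelicot Require Import Coquelicot.
Local Open Scope R_scope.

(* Stdlib's real numbers with Coquelicot.  E^3 is R * R * R; its vector-space
   operations are Coquelicot's plus, scal and zero on products. *)
Definition E3 : Type := (R * R * R)%type.

Definition c1 (v : E3) : R := fst (fst v).
Definition c2 (v : E3) : R := snd (fst v).
Definition c3 (v : E3) : R := snd v.

Definition dot (u v : E3) : R := c1 u * c1 v + c2 u * c2 v + c3 u * c3 v.

Definition enorm (v : E3) : R := sqrt (dot v v).

Definition cross (u v : E3) : E3 :=
  (c2 u * c3 v - c3 u * c2 v,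
   c3 u * c1 v - c1 u * c3 v,
   c1 u * c2 v - c2 u * c1 v).

(* Nonempty exactly when Rbar_lt a b; infinite endpoints are allowed. *)
Definition open_itv (a b : Rbar) (s : R) : Prop := Rbar_lt a s /\ Rbar_lt s b.

(* Curves are total functions of which only the values on an open interval
   matter: the derivatives at its points depend on nothing else. *)
Definition vderive (f : R -> E3) (s : R) : E3 :=
  (Derive (fun t => c1 (f t)) s,
   Derive (fun t => c2 (f t)) s,
   Derive (fun t => c3 (f t)) s).

Definition smooth_on (a b : Rbar) (f : R -> E3) : Prop :=
  forall (n : nat) (s : R), open_itv a b s ->
    ex_derive_n (fun t => c1 (f t)) n s /\
    ex_derive_n (fun t => c2 (f t)) n s /\
    ex_derive_n (fun t => c3 (f t)) n s.

Definition regular_on (a b : Rbar) (f : R -> E3) : Prop :=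
  forall s : R, open_itv a b s -> vderive f s <> zero.

Definition unit_speed_on (a b : Rbar) (f : R -> E3) : Prop :=
  forall s : R, open_itv a b s -> enorm (vderive f s) = 1.

Definition normalize (v : E3) : E3 := scal (/ enorm v) v.

Definition frenet_T (alpha : R -> E3) : R -> E3 := vderive alpha.

Definition frenet_N (alpha : R -> E3) (s : R) : E3 :=
  normalize (vderive (frenet_T alpha) s).

Definition frenet_B (alpha : R -> E3) (s : R) : E3 :=
  cross (frenet_T alpha s) (frenet_N alpha s).

(* T' = kappa N with N = T' / |T'|. *)
Definition curvature (alpha : R -> E3) (s : R) : R :=
  enorm (vderive (frenet_T alpha) s).

(* B' = - tau N with N a unit vector. *)
Definition torsion (alpha : R -> E3) (s : R) : R :=
  - dot (vderive (frenet_B alpha) s) (frenet_N alpha s).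

(* A curve parametrized by the arclength of another one need not have unit
   speed, so its tangent is normalized. *)
Definition unit_tangent (f : R -> E3) (s : R) : E3 := normalize (vderive f s).

Definition on_line (p v q : E3) : Prop := exists c : R, q = plus p (scal c v).

Definition is_bertrand (a b : Rbar) (alpha : R -> E3) : Prop :=
  exists beta : R -> E3,
    smooth_on a b beta /\
    regular_on a b beta /\
    (exists s : R, open_itv a b s /\ beta s <> alpha s) /\
    forall s : R, open_itv a b s ->
      on_line (alpha s) (frenet_N alpha s) (beta s) /\
      dot (frenet_N alpha s) (unit_tangent beta s) = 0 /\
      exists m : R,
        vderive (unit_tangent beta) s = scal m (frenet_N alpha s).

(* Main.v *)
From Stdlib Require Import Reals Lra.
From Coquelicot Require Import Coquelicot.
Require Import Defs.
Local Open Scope R_scope.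

(** A curve whose points lie on the principal normals of [alpha] is
    [beta = alpha + c N].  If its velocity is orthogonal to [N], the offset [c]
    is a constant [lam] ([bertrand_offset_constant]), and the Frenet equations
    give [beta' = (1 - lam kappa) T + lam tau B] ([is_vderive_offset]).

    Let [V] be the unit tangent of [beta].  It is orthogonal to [N], and [T']
    and [B'] are multiples of [N], so the coordinates [p = V·T] and [q = V·B]
    have derivatives [V'·T] and [V'·B] ([is_derive_frame_coordinates]).  Hence
    [V'] is a multiple of [N] exactly when [p] and [q] are constant.

    If [beta] is a Bertrand mate, the constants satisfy
    [p |beta'| = 1 - lam kappa] and [q |beta'| = lam tau] with [q] nonzero.
    Taking absolute values in the second equation and eliminating [|beta'|]
    yields [lam kappa + eta |tau| = 1] with [eta = p |lam| / |q|], and [|tau|]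
    is the norm of [B'].

    Conversely, put [beta = alpha + lam N].  The linear relation turns the
    velocity into [eta |tau| T + lam tau B], of norm
    [|tau| sqrt (eta^2 + lam^2)], so [p] is constant.  Since [V] is a unit
    vector, [p^2 + q^2 = 1], so [q q' = 0], and [q] never vanishes.  The
    remaining obligation is that [beta] be smooth: [N] is a quotient by a
    Euclidean norm, so smooth functions have to be stable under products and
    under [f |-> / sqrt f] ([derivable_times_inv_sqrt]). *)

(** * Functions differentiable finitely often on an open set *)

(** Differentiating from the outside in, unlike [ex_derive_n], is what lets the
    product rule be iterated by a plain induction on [n]. *)
Fixpoint derivable_times (n : nat) (D : R -> Prop) (f : R -> R) : Prop :=
  match n with
  | O => True
  | S m => (forall s, D s -> ex_derive f s) /\ derivable_times m D (Derive f)
  end.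

Definition smooth_fun (D : R -> Prop) (f : R -> R) : Prop :=
  forall n, derivable_times n D f.

(** [Derive_n f (S n)] differentiates [Derive_n f n], so the two notions are
    matched by commuting one derivative past the others. *)
Lemma smooth_funE (D : R -> Prop) (f : R -> R) :
  smooth_fun D f <-> forall n s, D s -> ex_derive_n f n s.
Proof.
assert (shift : forall g n s,
          ex_derive_n g (S (S n)) s <-> ex_derive_n (Derive g) (S n) s).
{ intros g n s; simpl.
  assert (E : forall t, Derive_n (Derive g) n t = Derive (Derive_n g n) t).
  { intros t; change (Derive g) with (Derive_n g 1).
    now rewrite Derive_n_comp, PeanoNat.Nat.add_1_r. }
  split; apply ex_derive_ext; intros t; now rewrite E. }
split.
- intros H n; generalize (H n); clear H; revert f.
  induction n as [|n IH]; intros f H s Ds; [exact I|].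
  destruct H as [H1 H2]; destruct n as [|n]; [now apply H1|].
  apply shift, IH; trivial.
- intros H n; revert f H; induction n as [|n IH]; intros f H; [exact I|].
  split.
  + intros s Ds; exact (H 1%nat s Ds).
  + apply IH; intros m s Ds; destruct m as [|m]; [exact I|].
    apply (shift f m s), H; exact Ds.
Qed.

Lemma derivable_times_pred n D f :
  derivable_times (S n) D f -> derivable_times n D f.
Proof.
revert f; induction n as [|n IH]; intros f [H1 H2]; [exact I|].
split; [exact H1 | now apply IH].
Qed.

Lemma derivable_times_ext n (D : R -> Prop) (f g : R -> R) :
  open D -> (forall s, D s -> f s = g s) ->
  derivable_times n D f -> derivable_times n D g.
Proof.
intros oD; revert f g; induction n as [|n IH]; intros f g E H; [exact I|].
assert (L : forall s, D s -> locally s (fun t => f t = g t)).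
{ intros s Ds; generalize (oD s Ds); apply filter_imp; exact E. }
destruct H as [H1 H2]; split.
- intros s Ds; apply (ex_derive_ext_loc f); [now apply L | now apply H1].
- apply (IH (Derive f)); [|exact H2].
  intros s Ds; apply Derive_ext_loc; now apply L.
Qed.

Lemma derivable_times_const n (D : R -> Prop) (k : R) :
  open D -> derivable_times n D (fun _ => k).
Proof.
intros oD; revert k; induction n as [|n IH]; intros k; [exact I|]; split.
- intros s _; apply ex_derive_const.
- apply (derivable_times_ext n D (fun _ => 0)); trivial.
  intros s _; now rewrite Derive_const.
Qed.

Lemma derivable_times_plus n (D : R -> Prop) (f g : R -> R) :
  open D -> derivable_times n D f -> derivable_times n D g ->
  derivable_times n D (fun t => f t + g t).
Proof.
intros oD; revert f g; induction n as [|n IH]; intros f g Hf Hg; [exact I|].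
destruct Hf as [f1 f2]; destruct Hg as [g1 g2]; split.
- intros s Ds; apply @ex_derive_plus; auto.
- apply (derivable_times_ext n D (fun t => Derive f t + Derive g t)); auto.
  intros s Ds; rewrite Derive_plus; auto.
Qed.

Lemma derivable_times_mult n (D : R -> Prop) (f g : R -> R) :
  open D -> derivable_times n D f -> derivable_times n D g ->
  derivable_times n D (fun t => f t * g t).
Proof.
intros oD; revert f g; induction n as [|n IH]; intros f g Hf Hg; [exact I|].
pose proof (derivable_times_pred _ _ _ Hf) as f0.
pose proof (derivable_times_pred _ _ _ Hg) as g0.
destruct Hf as [f1 f2]; destruct Hg as [g1 g2]; split.
- intros s Ds; apply ex_derive_mult; auto.
- apply (derivable_times_ext n D (fun t => Derive f t * g t + f t * Derive g t));
    auto using derivable_times_plus.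
  intros s Ds; rewrite Derive_mult; auto.
Qed.

(** The derivative of [h = / sqrt f] is the polynomial [- f' h^3 / 2] in [h]
    and [f'], so the induction closes on [h] itself. *)
Lemma derivable_times_inv_sqrt n (D : R -> Prop) (f : R -> R) :
  open D -> (forall s, D s -> 0 < f s) -> derivable_times n D f ->
  derivable_times n D (fun t => / sqrt (f t)).
Proof.
intros oD pos; induction n as [|n IH]; intros Hf; [exact I|].
pose proof (IH (derivable_times_pred _ _ _ Hf)) as h0.
destruct Hf as [f1 f2].
assert (d : forall s, D s -> is_derive (fun t => / sqrt (f t)) s
          (- / 2 * (Derive f s * (/ sqrt (f s) * (/ sqrt (f s) * / sqrt (f s)))))).
{ intros s Ds; assert (P := sqrt_lt_R0 _ (pos s Ds)).
  replace (- / 2 * _) with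
    (- (Derive f s / (2 * sqrt (f s))) / sqrt (f s) ^ 2) by (field; lra).
  apply (is_derive_inv (fun t => sqrt (f t))); [|lra].
  apply (is_derive_sqrt f); [apply Derive_correct|]; auto. }
split.
- intros s Ds; eexists; now apply d.
- apply (derivable_times_ext n D (fun s =>
    - / 2 * (Derive f s * (/ sqrt (f s) * (/ sqrt (f s) * / sqrt (f s)))))); trivial.
  + intros s Ds; symmetry; apply is_derive_unique; now apply d.
  + repeat apply derivable_times_mult; trivial; now apply derivable_times_const.
Qed.

(** * Algebra of Euclidean space *)

Lemma E3_ext (u v : E3) : c1 u = c1 v -> c2 u = c2 v -> c3 u = c3 v -> u = v.
Proof.
destruct u as [[x y] z]; destruct v as [[x' y'] z']; unfold c1, c2, c3; simpl.
congruence.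
Qed.

(** Matching is syntactic because unification would unfold the canonical
    structures on [E3]; what remains are polynomial identities in [R]. *)
Ltac coordinates :=
  unfold dot;
  repeat match goal with
  | |- context [c1 (@plus _ ?u ?v)] =>
      change (c1 (@plus _ u v)) with (c1 u + c1 v)
  | |- context [c2 (@plus _ ?u ?v)] =>
      change (c2 (@plus _ u v)) with (c2 u + c2 v)
  | |- context [c3 (@plus _ ?u ?v)] =>
      change (c3 (@plus _ u v)) with (c3 u + c3 v)
  | |- context [c1 (@minus _ ?u ?v)] =>
      change (c1 (@minus _ u v)) with (c1 u - c1 v)
  | |- context [c2 (@minus _ ?u ?v)] =>
      change (c2 (@minus _ u v)) with (c2 u - c2 v)
  | |- context [c3 (@minus _ ?u ?v)] =>
      change (c3 (@minus _ u v)) with (c3 u - c3 v)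
  | |- context [c1 (@scal _ _ ?k ?v)] =>
      change (c1 (@scal _ _ k v)) with (k * c1 v)
  | |- context [c2 (@scal _ _ ?k ?v)] =>
      change (c2 (@scal _ _ k v)) with (k * c2 v)
  | |- context [c3 (@scal _ _ ?k ?v)] =>
      change (c3 (@scal _ _ k v)) with (k * c3 v)
  | |- context [c1 (cross ?u ?v)] =>
      change (c1 (cross u v)) with (c2 u * c3 v - c3 u * c2 v)
  | |- context [c2 (cross ?u ?v)] =>
      change (c2 (cross u v)) with (c3 u * c1 v - c1 u * c3 v)
  | |- context [c3 (cross ?u ?v)] =>
      change (c3 (cross u v)) with (c1 u * c2 v - c2 u * c1 v)
  end.

Lemma dot_comm u v : dot u v = dot v u.
Proof. unfold dot; ring. Qed.

Lemma dot_plus_l (u v w : E3) : dot (plus u v) w = dot u w + dot v w.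
Proof. coordinates; ring. Qed.

Lemma dot_minus_l (u v w : E3) : dot (minus u v) w = dot u w - dot v w.
Proof. coordinates; ring. Qed.

Lemma dot_scal_l (k : R) (u w : E3) : dot (scal k u) w = k * dot u w.
Proof. coordinates; ring. Qed.

Lemma dot_zero_l (w : E3) : dot zero w = 0.
Proof.
unfold dot; change (c1 zero) with 0; change (c2 zero) with 0;
  change (c3 zero) with 0; ring.
Qed.

Lemma scal_1 (v : E3) : scal 1 v = v.
Proof. apply E3_ext; coordinates; ring. Qed.

Lemma dot_cross_l u v : dot (cross u v) u = 0.
Proof. coordinates; ring. Qed.

Lemma dot_cross_r u v : dot (cross u v) v = 0.
Proof. coordinates; ring. Qed.

Lemma dot_ge0 v : 0 <= dot v v.
Proof. unfold dot; nra. Qed.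

Lemma dot_gt0 (v : E3) : v <> zero -> 0 < dot v v.
Proof.
intros nz; destruct (dot_ge0 v) as [|E]; [assumption|exfalso; apply nz].
destruct v as [[x y] z]; unfold dot, c1, c2, c3 in E; simpl in E.
apply E3_ext; unfold c1, c2, c3; simpl; unfold zero; simpl; nra.
Qed.

Lemma enorm_sqr v : enorm v * enorm v = dot v v.
Proof. apply sqrt_sqrt, dot_ge0. Qed.

Lemma enorm_gt0 (v : E3) : v <> zero -> 0 < enorm v.
Proof. intros nz; now apply sqrt_lt_R0, dot_gt0. Qed.

Lemma enorm_scal (k : R) (v : E3) : enorm (scal k v) = Rabs k * enorm v.
Proof.
unfold enorm; rewrite dot_scal_l, dot_comm, dot_scal_l.
rewrite <- Rmult_assoc, sqrt_mult; [|nra|apply dot_ge0].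
now rewrite <- sqrt_Rsqr_abs.
Qed.

Lemma dot_normalize (v : E3) : v <> zero -> dot (normalize v) (normalize v) = 1.
Proof.
intros nz; assert (P := enorm_gt0 v nz).
unfold normalize; rewrite dot_scal_l, dot_comm, dot_scal_l, <- enorm_sqr.
field; lra.
Qed.

Lemma scal_enorm_normalize (v : E3) : v <> zero -> scal (enorm v) (normalize v) = v.
Proof.
intros nz; assert (P := enorm_gt0 v nz); unfold normalize.
apply E3_ext; coordinates; field; lra.
Qed.

Definition orthonormal_pair (T N : E3) : Prop :=
  dot T T = 1 /\ dot N N = 1 /\ dot T N = 0.

Lemma dot_cross_cross (T N : E3) :
  orthonormal_pair T N -> dot (cross T N) (cross T N) = 1.
Proof.
intros [TT [NN TN]].
assert (lagrange : dot (cross T N) (cross T N)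
          = dot T T * dot N N - dot T N * dot T N) by (coordinates; ring).
rewrite lagrange, TT, NN, TN; ring.
Qed.

(** The double cross product formula, applied to [w × (v × w)] with
    [w = T × N], writes [(w·w) v] in terms of [T], [N] and [w] by a polynomial
    identity. *)
Lemma orthonormal_expansion (T N v : E3) : orthonormal_pair T N ->
  v = plus (plus (scal (dot v T) T) (scal (dot v N) N))
           (scal (dot v (cross T N)) (cross T N)).
Proof.
intros TN0; pose proof (dot_cross_cross T N TN0) as BB.
destruct TN0 as [TT [NN TN]].
assert (expand : scal (dot (cross T N) (cross T N)) v =
  plus (plus (scal (dot v T * dot N N - dot v N * dot T N) T)
             (scal (dot v N * dot T T - dot v T * dot T N) N))
       (scal (dot v (cross T N)) (cross T N))).
{ apply E3_ext; coordinates; ring. }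
rewrite BB, TT, NN, TN, scal_1 in expand.
rewrite expand at 1.
apply E3_ext; coordinates; ring.
Qed.

(** * Derivatives of vector-valued functions *)

Definition is_vderive (f : R -> E3) (s : R) (v : E3) : Prop :=
  is_derive (fun t => c1 (f t)) s (c1 v) /\
  is_derive (fun t => c2 (f t)) s (c2 v) /\
  is_derive (fun t => c3 (f t)) s (c3 v).

Lemma is_vderive_unique f s v : is_vderive f s v -> vderive f s = v.
Proof.
intros [d1 [d2 d3]]; apply E3_ext; apply is_derive_unique; assumption.
Qed.

Lemma is_vderive_ext_loc (f g : R -> E3) s v :
  locally s (fun t => f t = g t) -> is_vderive f s v -> is_vderive g s v.
Proof.
intros L [d1 [d2 d3]].
assert (ext : forall c : E3 -> R, locally s (fun t => c (f t) = c (g t))).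
{ intros c; generalize L; apply filter_imp; intros t E; now rewrite E. }
split; [|split].
- exact (is_derive_ext_loc _ _ _ _ (ext c1) d1).
- exact (is_derive_ext_loc _ _ _ _ (ext c2) d2).
- exact (is_derive_ext_loc _ _ _ _ (ext c3) d3).
Qed.

Lemma is_derive_Rmult (f g : R -> R) s df dg :
  is_derive f s df -> is_derive g s dg ->
  is_derive (fun t => f t * g t) s (df * g s + f s * dg).
Proof. intros Hf Hg; apply (is_derive_mult f g); trivial; exact Rmult_comm. Qed.

Lemma is_vderive_plus (f g : R -> E3) s df dg :
  is_vderive f s df -> is_vderive g s dg ->
  is_vderive (fun t => plus (f t) (g t)) s (plus df dg).
Proof.
intros [f1 [f2 f3]] [g1 [g2 g3]]; split; [|split].
- exact (is_derive_plus _ _ _ _ _ f1 g1).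
- exact (is_derive_plus _ _ _ _ _ f2 g2).
- exact (is_derive_plus _ _ _ _ _ f3 g3).
Qed.

Lemma is_vderive_minus (f g : R -> E3) s df dg :
  is_vderive f s df -> is_vderive g s dg ->
  is_vderive (fun t => minus (f t) (g t)) s (minus df dg).
Proof.
intros [f1 [f2 f3]] [g1 [g2 g3]]; split; [|split].
- exact (is_derive_minus _ _ _ _ _ f1 g1).
- exact (is_derive_minus _ _ _ _ _ f2 g2).
- exact (is_derive_minus _ _ _ _ _ f3 g3).
Qed.

Lemma is_vderive_scal (k : R) (f : R -> E3) s df :
  is_vderive f s df -> is_vderive (fun t => scal k (f t)) s (scal k df).
Proof.
intros [f1 [f2 f3]]; split; [|split].
- exact (is_derive_scal _ _ _ _ f1).
- exact (is_derive_scal _ _ _ _ f2).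
- exact (is_derive_scal _ _ _ _ f3).
Qed.

Lemma is_derive_dot (f g : R -> E3) s df dg :
  is_vderive f s df -> is_vderive g s dg ->
  is_derive (fun t => dot (f t) (g t)) s (dot df (g s) + dot (f s) dg).
Proof.
intros [f1 [f2 f3]] [g1 [g2 g3]]; unfold dot.
replace (_ + _ + _ + (_ + _ + _)) with
  (c1 df * c1 (g s) + c1 (f s) * c1 dg + (c2 df * c2 (g s) + c2 (f s) * c2 dg)
   + (c3 df * c3 (g s) + c3 (f s) * c3 dg)) by ring.
exact (is_derive_plus _ _ _ _ _ (is_derive_plus _ _ _ _ _
  (is_derive_Rmult _ _ _ _ _ f1 g1) (is_derive_Rmult _ _ _ _ _ f2 g2))
  (is_derive_Rmult _ _ _ _ _ f3 g3)).
Qed.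

Lemma is_vderive_cross (f g : R -> E3) s df dg :
  is_vderive f s df -> is_vderive g s dg ->
  is_vderive (fun t => cross (f t) (g t)) s
    (plus (cross df (g s)) (cross (f s) dg)).
Proof.
intros [f1 [f2 f3]] [g1 [g2 g3]].
assert (rule : forall p q u w dp dq du dw,
  is_derive p s dp -> is_derive q s dq -> is_derive u s du -> is_derive w s dw ->
  is_derive (fun t : R => p t * q t - u t * w t) s
    ((dp * q s - du * w s) + (p s * dq - u s * dw))).
{ intros p q u w dp dq du dw Hp Hq Hu Hw.
  replace (_ + _) with ((dp * q s + p s * dq) - (du * w s + u s * dw)) by ring.
  apply @is_derive_minus; now apply is_derive_Rmult. }
split; [|split].
- exact (rule _ _ _ _ _ _ _ _ f2 g3 f3 g2).
- exact (rule _ _ _ _ _ _ _ _ f3 g1 f1 g3).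
- exact (rule _ _ _ _ _ _ _ _ f1 g2 f2 g1).
Qed.

(** * Smooth curves *)

Lemma open_open_itv a b : open (open_itv a b).
Proof. apply open_and; [apply open_Rbar_gt | apply open_Rbar_lt]. Qed.

Lemma locally_open_itv (a b : Rbar) (P : R -> Prop) s :
  open_itv a b s -> (forall t, open_itv a b t -> P t) -> locally s P.
Proof.
intros Is H; generalize (open_open_itv a b s Is); apply filter_imp; exact H.
Qed.

Lemma open_itv_nonempty (a b : Rbar) : Rbar_lt a b -> exists s, open_itv a b s.
Proof.
unfold open_itv; destruct a as [a| |]; destruct b as [b| |]; simpl; intros ab;
  try contradiction.
- exists ((a + b) / 2); lra.
- exists (a + 1); lra.
- exists (b - 1); lra.
- exists 0; tauto.
Qed.

Lemma derive_0_constant (a b : Rbar) (f : R -> R) :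
  (forall s, open_itv a b s -> is_derive f s 0) ->
  forall s t, open_itv a b s -> open_itv a b t -> f s = f t.
Proof.
intros d.
assert (lt_case : forall s t, open_itv a b s -> open_itv a b t -> s < t ->
          f s = f t).
{ intros s t [as_ _] [_ tb] st; apply (eq_is_derive f s t); trivial.
  intros u [su ut]; apply d; split.
  - apply Rbar_lt_le_trans with s; [exact as_ | exact su].
  - apply Rbar_le_lt_trans with t; [exact ut | exact tb]. }
intros s t Is It; destruct (Rtotal_order s t) as [st|[->|ts]]; auto.
symmetry; auto.
Qed.

Lemma is_derive_constant (a b : Rbar) (f : R -> R) (k d : R) s :
  (forall t, open_itv a b t -> f t = k) -> open_itv a b s ->
  is_derive f s d -> d = 0.
Proof.
intros E Is Hd; apply is_derive_unique in Hd; rewrite <- Hd.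
rewrite (Derive_ext_loc f (fun _ => k)), Derive_const; trivial.
now apply (locally_open_itv a b).
Qed.

Lemma smooth_onE a b f : smooth_on a b f <->
  smooth_fun (open_itv a b) (fun t => c1 (f t)) /\
  smooth_fun (open_itv a b) (fun t => c2 (f t)) /\
  smooth_fun (open_itv a b) (fun t => c3 (f t)).
Proof.
split.
- intros H; split; [|split]; apply smooth_funE; intros n s Is; now apply H.
- intros [H1 [H2 H3]] n s Is.
  split; [|split]; now apply (proj1 (smooth_funE (open_itv a b) _)).
Qed.

Lemma smooth_on_vderive a b f :
  smooth_on a b f -> smooth_on a b (vderive f).
Proof.
intros H; apply smooth_onE in H; destruct H as [H1 [H2 H3]].
apply smooth_onE; split; [|split]; intros n;
  [apply (H1 (S n)) | apply (H2 (S n)) | apply (H3 (S n))].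
Qed.

Lemma smooth_on_is_vderive a b f s :
  smooth_on a b f -> open_itv a b s -> is_vderive f s (vderive f s).
Proof.
intros H Is; destruct (H 1%nat s Is) as [H1 [H2 H3]].
split; [|split]; now apply Derive_correct.
Qed.

Lemma smooth_on_plus a b f g : smooth_on a b f -> smooth_on a b g ->
  smooth_on a b (fun t => plus (f t) (g t)).
Proof.
intros Hf Hg; apply smooth_onE in Hf, Hg.
destruct Hf as [f1 [f2 f3]]; destruct Hg as [g1 [g2 g3]].
apply smooth_onE; split; [|split]; intros n.
- exact (derivable_times_plus n _ _ _ (open_open_itv a b) (f1 n) (g1 n)).
- exact (derivable_times_plus n _ _ _ (open_open_itv a b) (f2 n) (g2 n)).
- exact (derivable_times_plus n _ _ _ (open_open_itv a b) (f3 n) (g3 n)).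
Qed.

Lemma smooth_on_scal a b (k : R -> R) f :
  smooth_fun (open_itv a b) k -> smooth_on a b f ->
  smooth_on a b (fun t => scal (k t) (f t)).
Proof.
intros Hk Hf; apply smooth_onE in Hf; destruct Hf as [f1 [f2 f3]].
apply smooth_onE; split; [|split]; intros n.
- exact (derivable_times_mult n _ _ _ (open_open_itv a b) (Hk n) (f1 n)).
- exact (derivable_times_mult n _ _ _ (open_open_itv a b) (Hk n) (f2 n)).
- exact (derivable_times_mult n _ _ _ (open_open_itv a b) (Hk n) (f3 n)).
Qed.

Lemma smooth_on_normalize a b f :
  smooth_on a b f -> (forall s, open_itv a b s -> f s <> zero) ->
  smooth_on a b (fun t => normalize (f t)).
Proof.
intros Hf nz; apply smooth_on_scal; trivial.
apply smooth_onE in Hf; destruct Hf as [f1 [f2 f3]]; intros n.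
apply derivable_times_inv_sqrt.
- apply open_open_itv.
- intros s Is; now apply dot_gt0, nz.
- pose proof (open_open_itv a b) as oI.
  repeat apply derivable_times_plus; trivial;
    apply derivable_times_mult; trivial.
Qed.

(** * The Frenet frame *)

Definition biregular_unit_speed (a b : Rbar) (alpha : R -> E3) : Prop :=
  smooth_on a b alpha /\ unit_speed_on a b alpha /\
  forall s, open_itv a b s -> curvature alpha s <> 0.

Lemma enorm_zero : enorm zero = 0.
Proof.
unfold enorm; rewrite dot_zero_l; apply sqrt_0.
Qed.

Lemma curvature_vector_neq0 a b alpha s :
  biregular_unit_speed a b alpha -> open_itv a b s ->
  vderive (frenet_T alpha) s <> zero.
Proof.
intros [_ [_ k]] Is E; apply (k s Is); unfold curvature; rewrite E.
apply enorm_zero.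
Qed.

Lemma smooth_frenet_N a b alpha :
  biregular_unit_speed a b alpha -> smooth_on a b (frenet_N alpha).
Proof.
intros H; apply smooth_on_normalize.
- now apply smooth_on_vderive, smooth_on_vderive, H.
- intros s Is; now apply (curvature_vector_neq0 a b).
Qed.

Lemma is_vderive_T a b alpha s :
  biregular_unit_speed a b alpha -> open_itv a b s ->
  is_vderive (frenet_T alpha) s (scal (curvature alpha s) (frenet_N alpha s)).
Proof.
intros H Is; unfold curvature, frenet_N.
rewrite scal_enorm_normalize by now apply (curvature_vector_neq0 a b).
apply (smooth_on_is_vderive a b); trivial.
now apply smooth_on_vderive, H.
Qed.

Lemma dot_derive_unit (a b : Rbar) (f : R -> E3) s df :
  (forall t, open_itv a b t -> dot (f t) (f t) = 1) -> open_itv a b s ->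
  is_vderive f s df -> dot df (f s) = 0.
Proof.
intros unit Is Hf.
assert (E := is_derive_constant a b _ 1 _ s unit Is (is_derive_dot _ _ _ _ _ Hf Hf)).
rewrite (dot_comm (f s)) in E; lra.
Qed.

Lemma frenet_T_unit a b alpha s : biregular_unit_speed a b alpha ->
  open_itv a b s -> dot (frenet_T alpha s) (frenet_T alpha s) = 1.
Proof.
intros [_ [unit _]] Is; rewrite <- enorm_sqr; unfold frenet_T.
rewrite (unit s Is); ring.
Qed.

Lemma frenet_orthonormal a b alpha s :
  biregular_unit_speed a b alpha -> open_itv a b s ->
  orthonormal_pair (frenet_T alpha s) (frenet_N alpha s).
Proof.
intros H Is; split; [now apply (frenet_T_unit a b)|split].
- apply dot_normalize; now apply (curvature_vector_neq0 a b).
- assert (E := dot_derive_unit a b _ s _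
           (fun t => frenet_T_unit a b alpha t H) Is (is_vderive_T a b alpha s H Is)).
  rewrite dot_scal_l, dot_comm in E.
  apply Rmult_integral in E; destruct E as [E|E]; trivial.
  now destruct H as [_ [_ k]]; elim (k s Is).
Qed.

Lemma frenet_expansion a b alpha s v :
  biregular_unit_speed a b alpha -> open_itv a b s ->
  v = plus (plus (scal (dot v (frenet_T alpha s)) (frenet_T alpha s))
                 (scal (dot v (frenet_N alpha s)) (frenet_N alpha s)))
           (scal (dot v (frenet_B alpha s)) (frenet_B alpha s)).
Proof.
intros H Is; now apply orthonormal_expansion, (frenet_orthonormal a b).
Qed.

Lemma frenet_B_unit a b alpha s : biregular_unit_speed a b alpha ->
  open_itv a b s -> dot (frenet_B alpha s) (frenet_B alpha s) = 1.
Proof.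
intros H Is; now apply dot_cross_cross, (frenet_orthonormal a b).
Qed.

(** The product rule for [f·g = 0]; it moves derivatives between the vectors of
    the frame, which is how [N'·T] and [N'·B] follow from [T'] and [B']. *)
Lemma dot_derive_orthogonal (a b : Rbar) (f g : R -> E3) s df dg :
  (forall t, open_itv a b t -> dot (f t) (g t) = 0) -> open_itv a b s ->
  is_vderive f s df -> is_vderive g s dg -> dot df (g s) = - dot dg (f s).
Proof.
intros orth Is Hf Hg.
assert (E := is_derive_constant a b _ 0 _ s orth Is (is_derive_dot _ _ _ _ _ Hf Hg)).
rewrite (dot_comm dg); lra.
Qed.

(** [B' = T' × N + T × N'] shows that [B] is differentiable; the value comes from
    its coordinates in the frame, where [B'·T = - B·T' = 0] as [T'] is parallel
    to [N], [B'·B = 0] as [B] is a unit vector, and [B'·N] is [- tau] by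
    definition of the torsion. *)
Lemma is_vderive_B a b alpha s :
  biregular_unit_speed a b alpha -> open_itv a b s ->
  is_vderive (frenet_B alpha) s (scal (- torsion alpha s) (frenet_N alpha s)).
Proof.
intros H Is; assert (on := fun t => frenet_orthonormal a b alpha t H).
assert (dT := is_vderive_T a b alpha s H Is).
assert (dN := smooth_on_is_vderive a b _ s (smooth_frenet_N a b alpha H) Is).
assert (dB := is_vderive_cross _ _ _ _ _ dT dN).
change (fun t => cross (frenet_T alpha t) (frenet_N alpha t))
  with (frenet_B alpha) in dB.
assert (EB := is_vderive_unique _ _ _ dB); rewrite <- EB in dB; clear EB.
assert (BT : dot (vderive (frenet_B alpha) s) (frenet_T alpha s) = 0).
{ rewrite (dot_derive_orthogonal a b _ _ s _ _
            (fun t _ => dot_cross_l _ _) Is dB dT).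
  rewrite dot_scal_l, dot_comm; unfold frenet_B; rewrite dot_cross_r; ring. }
assert (BB := dot_derive_unit a b _ s _
                (fun t => frenet_B_unit a b alpha t H) Is dB).
unfold torsion; rewrite Ropp_involutive.
replace (scal _ _) with (vderive (frenet_B alpha) s); [exact dB|].
rewrite (frenet_expansion a b alpha s (vderive (frenet_B alpha) s) H Is) at 1.
rewrite BT, BB.
apply E3_ext; coordinates; ring.
Qed.

Lemma is_vderive_N a b alpha s :
  biregular_unit_speed a b alpha -> open_itv a b s ->
  is_vderive (frenet_N alpha) s
    (plus (scal (- curvature alpha s) (frenet_T alpha s))
          (scal (torsion alpha s) (frenet_B alpha s))).
Proof.
intros H Is; assert (on := fun t => frenet_orthonormal a b alpha t H).
assert (dT := is_vderive_T a b alpha s H Is).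
assert (dB := is_vderive_B a b alpha s H Is).
assert (dN := smooth_on_is_vderive a b _ s (smooth_frenet_N a b alpha H) Is).
assert (NT := dot_derive_orthogonal a b _ _ s _ _
                (fun t It => proj2 (proj2 (on t It))) Is dT dN).
assert (NN := dot_derive_unit a b _ s _
                (fun t It => proj1 (proj2 (on t It))) Is dN).
assert (NB := dot_derive_orthogonal a b (frenet_B alpha) _ s _ _
                (fun t _ => dot_cross_r _ _) Is dB dN).
rewrite dot_scal_l, (proj1 (proj2 (on s Is))) in NT, NB.
replace (plus _ _) with (vderive (frenet_N alpha) s); [exact dN|].
rewrite (frenet_expansion a b alpha s (vderive (frenet_N alpha) s) H Is) at 1.
replace (dot _ (frenet_T alpha s)) with (- curvature alpha s) by lra.
replace (dot _ (frenet_B alpha s)) with (torsion alpha s) by lra.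
rewrite NN; apply E3_ext; coordinates; ring.
Qed.

Lemma enorm_B' a b alpha s :
  biregular_unit_speed a b alpha -> open_itv a b s ->
  enorm (vderive (frenet_B alpha) s) = Rabs (torsion alpha s).
Proof.
intros H Is; rewrite (is_vderive_unique _ _ _ (is_vderive_B a b alpha s H Is)).
rewrite enorm_scal, Rabs_Ropp; unfold enorm.
rewrite (proj1 (proj2 (frenet_orthonormal a b alpha s H Is))), sqrt_1; ring.
Qed.

(** * Curves along the principal normal *)

Lemma is_vderive_offset a b alpha beta (lam : R) s :
  biregular_unit_speed a b alpha -> open_itv a b s ->
  (forall t, open_itv a b t -> beta t = plus (alpha t) (scal lam (frenet_N alpha t))) ->
  is_vderive beta s
    (plus (scal (1 - lam * curvature alpha s) (frenet_T alpha s))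
          (scal (lam * torsion alpha s) (frenet_B alpha s))).
Proof.
intros H Is E.
apply (is_vderive_ext_loc (fun t => plus (alpha t) (scal lam (frenet_N alpha t)))).
{ apply (locally_open_itv a b); trivial; intros t It; now rewrite E. }
replace (plus _ _) with
  (plus (vderive alpha s) (scal lam
    (plus (scal (- curvature alpha s) (frenet_T alpha s))
          (scal (torsion alpha s) (frenet_B alpha s))))).
- apply is_vderive_plus.
  + now apply (smooth_on_is_vderive a b); [apply H|].
  + now apply is_vderive_scal, (is_vderive_N a b).
- fold (frenet_T alpha s); apply E3_ext; coordinates; ring.
Qed.

(** Differentiating [c = (beta - alpha)·N] gives
    [c' = (beta' - T)·N + (c N)·N'], in which every term vanishes. *)
Lemma bertrand_offset_constant a b alpha beta :
  biregular_unit_speed a b alpha -> smooth_on a b beta ->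
  (forall s, open_itv a b s -> on_line (alpha s) (frenet_N alpha s) (beta s)) ->
  (forall s, open_itv a b s -> dot (frenet_N alpha s) (vderive beta s) = 0) ->
  forall s0, open_itv a b s0 -> exists lam : R, forall s, open_itv a b s ->
    beta s = plus (alpha s) (scal lam (frenet_N alpha s)).
Proof.
intros H Hb line orth s0 I0.
assert (on := fun t => frenet_orthonormal a b alpha t H).
set (c := fun s => dot (minus (beta s) (alpha s)) (frenet_N alpha s)).
assert (Ec : forall s, open_itv a b s ->
          minus (beta s) (alpha s) = scal (c s) (frenet_N alpha s)).
{ intros s Is; destruct (line s Is) as [k Ek]; destruct (on s Is) as [_ [NN _]].
  assert (D : minus (beta s) (alpha s) = scal k (frenet_N alpha s)).
  { rewrite Ek; apply E3_ext; coordinates; ring. }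
  unfold c; rewrite D, dot_scal_l, NN; f_equal; ring. }
exists (c s0); intros s Is.
replace (c s0) with (c s).
{ rewrite <- (Ec s Is); apply E3_ext; coordinates; ring. }
apply (derive_0_constant a b); trivial; clear s Is; intros s Is.
assert (dN := smooth_on_is_vderive a b _ s (smooth_frenet_N a b alpha H) Is).
assert (NN := dot_derive_unit a b _ s _
                (fun t It => proj1 (proj2 (on t It))) Is dN).
assert (d := is_derive_dot _ _ _ _ _ (is_vderive_minus _ _ _ _ _
               (smooth_on_is_vderive a b _ s Hb Is)
               (smooth_on_is_vderive a b _ s (proj1 H) Is)) dN).
replace 0 with (dot (minus (vderive beta s) (vderive alpha s)) (frenet_N alpha s)
  + dot (minus (beta s) (alpha s)) (vderive (frenet_N alpha) s)); [exact d|].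
rewrite (Ec s Is), dot_minus_l, dot_scal_l, (dot_comm (vderive beta s)).
rewrite (orth s Is), (dot_comm (frenet_N alpha s)), NN.
fold (frenet_T alpha s); rewrite (proj2 (proj2 (on s Is))); ring.
Qed.

(** As [T'] and [B'] point along [N], a field [V] that stays orthogonal to [N]
    does not feel the rotation of [T] and [B]. *)
Lemma is_derive_frame_coordinates a b alpha V s dV :
  biregular_unit_speed a b alpha -> open_itv a b s ->
  is_vderive V s dV -> dot (frenet_N alpha s) (V s) = 0 ->
  is_derive (fun t => dot (V t) (frenet_T alpha t)) s (dot dV (frenet_T alpha s)) /\
  is_derive (fun t => dot (V t) (frenet_B alpha t)) s (dot dV (frenet_B alpha s)).
Proof.
intros H Is HV orth.
assert (zero_term : forall k : R, dot (V s) (scal k (frenet_N alpha s)) = 0).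
{ intros k; rewrite dot_comm, dot_scal_l, orth; ring. }
split.
- rewrite <- (Rplus_0_r (dot dV _)), <- (zero_term (curvature alpha s)).
  now apply is_derive_dot, (is_vderive_T a b).
- rewrite <- (Rplus_0_r (dot dV _)), <- (zero_term (- torsion alpha s)).
  now apply is_derive_dot, (is_vderive_B a b).
Qed.

Lemma smooth_unit_tangent a b beta : smooth_on a b beta -> regular_on a b beta ->
  smooth_on a b (unit_tangent beta).
Proof.
intros Hb reg; apply smooth_on_normalize; trivial.
now apply smooth_on_vderive.
Qed.

Lemma dot_unit_tangent (beta : R -> E3) s w :
  dot (unit_tangent beta s) w = / enorm (vderive beta s) * dot (vderive beta s) w.
Proof. apply dot_scal_l. Qed.

Lemma frame_coordinates (T N : E3) (x y : R) : orthonormal_pair T N ->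
  dot (plus (scal x T) (scal y (cross T N))) T = x /\
  dot (plus (scal x T) (scal y (cross T N))) N = 0 /\
  dot (plus (scal x T) (scal y (cross T N))) (cross T N) = y.
Proof.
intros on; assert (BB := dot_cross_cross T N on); destruct on as [TT [NN TN]].
assert (TB := dot_cross_l T N); assert (NB := dot_cross_r T N).
rewrite !dot_plus_l, !dot_scal_l, TT, TN, BB, NB, TB.
rewrite (dot_comm T (cross T N)), TB; repeat split; ring.
Qed.

(** [p] and [q] being constant, eliminating the speed of the mate from
    [p |beta'| = 1 - lam kappa] and [q |beta'| = lam tau] leaves the relation.
    Since [tau] and [lam] are nonzero so is [q], by which one has to divide. *)
Lemma bertrand_linear_relation a b alpha :
  biregular_unit_speed a b alpha ->
  (forall s, open_itv a b s -> torsion alpha s <> 0) ->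
  is_bertrand a b alpha ->
  exists lam eta : R, lam <> 0 /\ forall s, open_itv a b s ->
    lam * curvature alpha s + eta * Rabs (torsion alpha s) = 1.
Proof.
intros H htau [beta [Hb [reg [[s0 [I0 ne]] Hbert]]]].
assert (on := fun t => frenet_orthonormal a b alpha t H).
assert (vpos : forall s, open_itv a b s -> 0 < enorm (vderive beta s)).
{ intros s Is; apply enorm_gt0, reg, Is. }
assert (orthV : forall s, open_itv a b s ->
          dot (frenet_N alpha s) (unit_tangent beta s) = 0).
{ intros s Is; now apply Hbert. }
destruct (bertrand_offset_constant a b alpha beta H Hb) with (s0 := s0)
  as [lam Elam]; trivial.
{ intros s Is; now apply Hbert. }
{ intros s Is; assert (P := vpos s Is); assert (O := orthV s Is).
  rewrite dot_comm, dot_unit_tangent in O; rewrite dot_comm.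
  apply Rmult_integral in O; destruct O as [O|O]; trivial.
  apply Rinv_0_lt_compat in P; lra. }
assert (lam0 : lam <> 0).
{ intros E; apply ne; rewrite (Elam s0 I0), E; apply E3_ext; coordinates; ring. }
set (p := fun s => dot (unit_tangent beta s) (frenet_T alpha s)).
set (q := fun s => dot (unit_tangent beta s) (frenet_B alpha s)).
assert (const : forall s, open_itv a b s -> is_derive p s 0 /\ is_derive q s 0).
{ intros s Is; destruct (Hbert s Is) as [_ [_ [m Em]]].
  assert (dV := smooth_on_is_vderive a b _ s (smooth_unit_tangent a b beta Hb reg) Is).
  rewrite Em in dV.
  destruct (is_derive_frame_coordinates a b alpha _ s _ H Is dV (orthV s Is))
    as [dp dq].
  rewrite dot_scal_l, dot_comm, (proj2 (proj2 (on s Is))), Rmult_0_r in dp.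
  rewrite dot_scal_l, dot_comm in dq; unfold frenet_B at 2 in dq.
  rewrite dot_cross_r, Rmult_0_r in dq; split; assumption. }
assert (speed : forall s, open_itv a b s ->
   p s0 * enorm (vderive beta s) = 1 - lam * curvature alpha s /\
   q s0 * enorm (vderive beta s) = lam * torsion alpha s).
{ intros s Is; assert (P := vpos s Is).
  rewrite (derive_0_constant a b p (fun t It => proj1 (const t It)) s0 s I0 Is).
  rewrite (derive_0_constant a b q (fun t It => proj2 (const t It)) s0 s I0 Is).
  destruct (frame_coordinates _ _ (1 - lam * curvature alpha s)
              (lam * torsion alpha s) (on s Is)) as [x [_ y]].
  unfold p, q; rewrite !dot_unit_tangent.
  set (v := enorm _) in *.
  rewrite (is_vderive_unique _ _ _ (is_vderive_offset a b alpha beta lam s H Is Elam)).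
  fold (frenet_B alpha s) in x, y; rewrite x, y; split; field; lra. }
assert (q0 : q s0 <> 0).
{ intros E; destruct (speed s0 I0) as [_ Eq]; rewrite E, Rmult_0_l in Eq.
  symmetry in Eq; apply Rmult_integral in Eq.
  destruct Eq as [|Et]; [contradiction | exact (htau s0 I0 Et)]. }
(* [|q| |beta'| = |lam| |tau|], so [p |beta'| = p (|lam| / |q|) |tau|] *)
exists lam, (p s0 * (Rabs lam / Rabs (q s0))); split; trivial.
intros s Is; destruct (speed s Is) as [Ep Eq]; assert (P := vpos s Is).
apply (f_equal Rabs) in Eq; rewrite !Rabs_mult, (Rabs_pos_eq (enorm _)) in Eq by lra.
assert (Q := Rabs_no_R0 _ q0).
replace (_ * Rabs (torsion alpha s)) with
  (p s0 * (Rabs lam * Rabs (torsion alpha s) / Rabs (q s0))) by (field; trivial).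
rewrite <- Eq.
replace (_ / _) with (enorm (vderive beta s)) by (field; trivial).
rewrite Ep; ring.
Qed.

(** The mate is [alpha + lam N].  Only the coordinate [p] of its unit tangent is
    computed, because the sign of [tau] disappears from it; the coordinate [q]
    is then constant up to sign because the tangent has norm one. *)
Lemma linear_relation_bertrand a b alpha (lam eta : R) : Rbar_lt a b ->
  biregular_unit_speed a b alpha ->
  (forall s, open_itv a b s -> torsion alpha s <> 0) -> lam <> 0 ->
  (forall s, open_itv a b s ->
     lam * curvature alpha s + eta * Rabs (torsion alpha s) = 1) ->
  is_bertrand a b alpha.
Proof.
intros ab H htau lam0 rel.
assert (on := fun t => frenet_orthonormal a b alpha t H).
set (beta := fun t => plus (alpha t) (scal lam (frenet_N alpha t))).
set (r := sqrt (eta * eta + lam * lam)).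
assert (r0 : 0 < r) by (apply sqrt_lt_R0; nra).
assert (Hb : smooth_on a b beta).
{ apply smooth_on_plus; [apply H|].
  apply (smooth_on_scal a b (fun _ => lam)); [|now apply smooth_frenet_N].
  intros n; apply derivable_times_const, open_open_itv. }
assert (vel : forall s, open_itv a b s -> vderive beta s =
   plus (scal (eta * Rabs (torsion alpha s)) (frenet_T alpha s))
        (scal (lam * torsion alpha s) (cross (frenet_T alpha s) (frenet_N alpha s)))).
{ intros s Is.
  rewrite (is_vderive_unique _ _ _
            (is_vderive_offset a b alpha beta lam s H Is (fun t _ => eq_refl))).
  assert (E := rel s Is).
  now replace (1 - _) with (eta * Rabs (torsion alpha s)) by lra. }
assert (coords : forall s, open_itv a b s ->
   dot (vderive beta s) (frenet_T alpha s) = eta * Rabs (torsion alpha s) /\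
   dot (vderive beta s) (frenet_N alpha s) = 0 /\
   dot (vderive beta s) (frenet_B alpha s) = lam * torsion alpha s).
{ intros s Is; rewrite (vel s Is); now apply frame_coordinates, on. }
assert (reg : regular_on a b beta).
{ intros s Is E; destruct (coords s Is) as [_ [_ y]]; rewrite E in y.
  rewrite dot_zero_l in y; symmetry in y; apply Rmult_integral in y.
  destruct y as [|y]; [contradiction | exact (htau s Is y)]. }
assert (speed : forall s, open_itv a b s ->
          enorm (vderive beta s) = Rabs (torsion alpha s) * r).
{ intros s Is; destruct (coords s Is) as [x [_ y]].
  unfold enorm, r; rewrite <- (sqrt_Rsqr_abs (torsion alpha s)), <- sqrt_mult
    by (unfold Rsqr; nra).
  f_equal; rewrite (vel s Is) at 2; fold (frenet_B alpha s).
  rewrite dot_comm, dot_plus_l, !dot_scal_l, (dot_comm (frenet_T _ _)), x.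
  rewrite (dot_comm (frenet_B _ _)), y.
  assert (A := Rsqr_abs (torsion alpha s)); unfold Rsqr in *.
  replace (_ + _) with (eta * eta * (Rabs (torsion alpha s) * Rabs (torsion alpha s))
    + lam * lam * (torsion alpha s * torsion alpha s)) by ring.
  rewrite <- A; ring. }
exists beta; split; [exact Hb|split; [exact reg|split]].
- destruct (open_itv_nonempty a b ab) as [s Is]; exists s; split; trivial.
  intros E; apply lam0.
  assert (D : scal lam (frenet_N alpha s) = minus (beta s) (alpha s)).
  { unfold beta; apply E3_ext; coordinates; ring. }
  assert (Z : dot (scal lam (frenet_N alpha s)) (frenet_N alpha s) = 0).
  { rewrite D, E, dot_minus_l; ring. }
  rewrite dot_scal_l, (proj1 (proj2 (on s Is))) in Z; lra.
- assert (orthV : forall s, open_itv a b s ->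
            dot (frenet_N alpha s) (unit_tangent beta s) = 0).
  { intros s Is; rewrite dot_comm, dot_unit_tangent.
    rewrite (proj1 (proj2 (coords s Is))); ring. }
  intros s Is; split; [now exists lam | split; [now apply orthV|]].
  assert (dV := smooth_on_is_vderive a b _ s (smooth_unit_tangent a b beta Hb reg) Is).
  destruct (is_derive_frame_coordinates a b alpha _ s _ H Is dV (orthV s Is))
    as [dp _].
  set (V := unit_tangent beta) in *.
  assert (T0 : dot (vderive V s) (frenet_T alpha s) = 0).
  { apply (is_derive_constant a b _ (eta / r) _ s) in dp; trivial.
    intros t It; destruct (coords t It) as [x _].
    unfold V; rewrite dot_unit_tangent, x, (speed t It).
    assert (A := Rabs_no_R0 _ (htau t It)); field; lra. }
  assert (unitV := dot_derive_unit a b V s _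
    (fun t It => dot_normalize _ (reg t It)) Is dV).
  (* [V·V' = 0] and [V'·T = 0] leave only [(V·B) (V'·B) = 0] *)
  assert (B0 : dot (vderive V s) (frenet_B alpha s) = 0).
  { unfold V in unitV at 2; rewrite dot_comm, dot_unit_tangent in unitV.
    rewrite (vel s Is), dot_plus_l, !dot_scal_l in unitV.
    fold (frenet_B alpha s) in unitV.
    rewrite (dot_comm (frenet_T _ _)), (dot_comm (frenet_B _ _)), T0 in unitV.
    rewrite Rmult_0_r, Rplus_0_l in unitV.
    assert (P := enorm_gt0 _ (reg s Is)); apply Rinv_0_lt_compat in P.
    rewrite (vel s Is) in P; fold (frenet_B alpha s) in P.
    apply Rmult_integral in unitV; destruct unitV as [|unitV]; [lra|].
    apply Rmult_integral in unitV; destruct unitV as [E|]; trivial.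
    apply Rmult_integral in E; destruct E as [|E]; [contradiction|].
    elim (htau s Is E). }
  exists (dot (vderive V s) (frenet_N alpha s)).
  rewrite (frenet_expansion a b alpha s (vderive V s) H Is) at 1.
  rewrite T0, B0.
  apply E3_ext; coordinates; ring.
Qed.

Theorem theorem11 (a b : Rbar) (hab : Rbar_lt a b) (alpha : R -> E3)
    (hsmooth : smooth_on a b alpha)
    (hunit : unit_speed_on a b alpha)
    (hkappa : forall s : R, open_itv a b s -> curvature alpha s <> 0)
    (htau : forall s : R, open_itv a b s -> torsion alpha s <> 0) :
  is_bertrand a b alpha <->
  exists lam eta : R, lam <> 0 /\
    forall s : R, open_itv a b s ->
      lam * enorm (vderive (frenet_T alpha) s)
        + eta * enorm (vderive (frenet_B alpha) s) = 1.
Proof.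
assert (H : biregular_unit_speed a b alpha) by (split; [|split]; assumption).
split.
- intros hb; destruct (bertrand_linear_relation a b alpha H htau hb)
    as [lam [eta [lam0 rel]]].
  exists lam, eta; split; trivial; intros s Is.
  rewrite (enorm_B' a b alpha s H Is); exact (rel s Is).
- intros [lam [eta [lam0 rel]]].
  apply (linear_relation_bertrand a b alpha lam eta); trivial; intros s Is.
  rewrite <- (enorm_B' a b alpha s H Is); exact (rel s Is).
Qed.
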